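(* Let $\mathcal{E}$ be an idempotent complete exact category. The assignments $\mathcal{T}\mapsto\mathcal{T}^\perp$ and $\mathcal{X}\mapsto\mathcal{P}(\mathcal{X})$ are mutually inverse bijections between (1) the class of tilting subcategories $\mathcal{T}$ of $\mathcal{E}$, and (2) the class of finitely coresolving subcategories $\mathcal{X}$ of $\mathcal{E}$ which have enough projectives $\mathcal{P}(\mathcal{X})$ and satisfy $\mathcal{X}=\mathcal{P}(\mathcal{X})^\perp$. Moreover, for every $n\ge 0$, the same assignments are mutually inverse bijections between the class of $n$-tilting subcategories of $\mathcal{E}$ and the class of those $\mathcal{X}$ as in (2) which in addition satisfy $\mathrm{Cores}_n(\mathcal{X})=\mathcal{E}$.
   Context: Exact categories are in the sense of Quillen; subcategories are full, additive and closed under isomorphism. $\mathrm{Ext}^i_{\mathcal{E}}$ is Yoneda Ext. A sequence in $\mathcal{E}$ is exact if it is obtained by splicing short exact sequences of $\mathcal{E}$. An extension-closed subcategory $\mathcal{X}$ is regarded as an exact category (fully exact subcategory) with the short exact sequences of $\mathcal{E}$ all of whose terms lie in it; $\mathcal{P}(\mathcal{X})$ denotes its subcategory of projective objects. For a subcategory $\mathcal{X}$ of $\mathcal{E}$: $\mathcal{X}^{\perp}=\{M\in\mathcal{E}: \mathrm{Ext}^i_{\mathcal{E}}(X,M)=0\ \forall i\ge 1, X\in\mathcal{X}\}$; $\mathrm{Cores}_n(\mathcal{X})$ is the class of $M$ admitting an exact sequence $0\to M\to X_0\to\cdots\to X_n\to 0$ with $X_i\in\mathcal{X}$; $\mathrm{Cores}(\mathcal{X})=\bigcup_n\mathrm{Cores}_n(\mathcal{X})$.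 $\mathcal{X}$ is coresolving if it is extension-closed, inflation-closed (cokernels of inflations between objects of $\mathcal{X}$ lie in $\mathcal{X}$) and every object of $\mathcal{E}$ admits an inflation into an object of $\mathcal{X}$; it is finitely coresolving if moreover $\mathrm{Cores}(\mathcal{X})=\mathcal{E}$. A subcategory $\mathcal{T}$ of $\mathcal{E}$ is tilting if (T1) $\mathcal{T}\subset\mathcal{T}^\perp$ and the fully exact subcategory $\mathcal{T}^{\perp}$ has enough projectives, with $\mathcal{P}(\mathcal{T}^\perp)=\mathcal{T}$; and (T2) $\mathcal{T}^\perp$ is finitely coresolving. It is $n$-tilting if it is tilting and $\mathrm{Cores}_n(\mathcal{T}^\perp)=\mathcal{E}$. *)

(* Defs.v *)
From Stdlib Require Import Relations.
From mathcomp Require Import all_boot all_algebra.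
From mathcomp Require Import boolp classical_sets functions.

Set Implicit Arguments.
Unset Strict Implicit.
Unset Printing Implicit Defensive.

Local Open Scope classical_set_scope.
Local Open Scope ring_scope.

Declare Scope cat_scope.
Delimit Scope cat_scope with cat.
Local Open Scope cat_scope.

Record preadditiveCategory := PreadditiveCategory {
  ob :> Type;
  hom : ob -> ob -> zmodType;
  idm : forall A, hom A A;
  comp : forall A B C, hom B C -> hom A B -> hom A C;
  compA : forall A B C D (h : hom C D) (g : hom B C) (f : hom A B),
    comp h (comp g f) = comp (comp h g) f;
  comp1m : forall A B (f : hom A B), comp (idm B) f = f;
  compm1 : forall A B (f : hom A B), comp f (idm A) = f;
  compDl : forall A B C (g g' : hom B C) (f : hom A B),
    comp (g + g') f = comp g f + comp g' f;
  compDr : forall A B C (g : hom B C) (f f' : hom A B),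
    comp g (f + f') = comp g f + comp g f'
}.

Arguments hom {p} _ _.
Arguments idm {p} A.
Arguments comp {p A B C} _ _.

Notation "g ∘ f" := (comp g f) (at level 40, left associativity) : cat_scope.

Section Preadditive.
Variable C : preadditiveCategory.
Implicit Types A B X Y Z : C.

Definition is_iso A B (f : hom A B) : Prop :=
  exists g : hom B A, g ∘ f = idm A /\ f ∘ g = idm B.

Definition isomorphic A B : Prop := exists f : hom A B, is_iso f.

Definition is_zero_object Z : Prop :=
  (forall A (f : hom A Z), f = 0) /\ (forall A (f : hom Z A), f = 0).

Definition is_biproduct A B S (iA : hom A S) (iB : hom B S)
    (pA : hom S A) (pB : hom S B) : Prop :=
  [/\ pA ∘ iA = idm A, pB ∘ iB = idm B, pA ∘ iB = 0, pB ∘ iA = 0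
    & iA ∘ pA + iB ∘ pB = idm S].

Definition is_direct_sum A B S : Prop :=
  exists iA iB pA pB, @is_biproduct A B S iA iB pA pB.

Definition is_kernel A B X (f : hom A B) (g : hom B X) : Prop :=
  g ∘ f = 0 /\
  forall Y (h : hom Y B), g ∘ h = 0 -> exists! k : hom Y A, f ∘ k = h.

Definition is_cokernel A B X (f : hom A B) (g : hom B X) : Prop :=
  g ∘ f = 0 /\
  forall Y (h : hom B Y), h ∘ f = 0 -> exists! k : hom X Y, k ∘ g = h.

Definition is_pushout A B A' B' (f : hom A B) (a : hom A A')
    (f' : hom A' B') (b : hom B B') : Prop :=
  b ∘ f = f' ∘ a /\
  forall Y (u : hom B Y) (v : hom A' Y), u ∘ f = v ∘ a ->
    exists! w : hom B' Y, w ∘ b = u /\ w ∘ f' = v.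

Definition is_pullback B X B' X' (g : hom B X) (c : hom X' X)
    (g' : hom B' X') (b : hom B' B) : Prop :=
  g ∘ b = c ∘ g' /\
  forall Y (u : hom Y B) (v : hom Y X'), g ∘ u = c ∘ v ->
    exists! w : hom Y B', b ∘ w = u /\ g' ∘ w = v.

Definition idempotent_complete : Prop :=
  forall A (e : hom A A), e ∘ e = e ->
    exists B (r : hom A B) (s : hom B A), s ∘ r = e /\ r ∘ s = idm B.

End Preadditive.

Record additiveCategory := AdditiveCategory {
  add_cat :> preadditiveCategory;
  zero_exists : exists Z : add_cat, is_zero_object Z;
  sum_exists : forall A B : add_cat, exists S : add_cat, is_direct_sum A B S
}.

(* Quillen's axioms, in the self-dual form used by Keller and Bühler.
   [conflation f g] says that A -f-> B -g-> C is a distinguished short exact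
   sequence; the first map of such a pair is an inflation and the second one a
   deflation. *)
Record exactCategory := ExactCategory {
  exact_cat :> additiveCategory;
  conflation : forall A B C : exact_cat, hom A B -> hom B C -> Prop;
  inflation : forall A B : exact_cat, hom A B -> Prop :=
    fun A B f => exists C (g : hom B C), conflation f g;
  deflation : forall B C : exact_cat, hom B C -> Prop :=
    fun B C g => exists A (f : hom A B), conflation f g;
  conflation_kernel : forall (A B C : exact_cat) (f : hom A B) (g : hom B C),
    conflation f g -> is_kernel f g;
  conflation_cokernel : forall (A B C : exact_cat) (f : hom A B) (g : hom B C),
    conflation f g -> is_cokernel f g;
  conflation_iso : forall (A B C A' B' C' : exact_cat)
      (f : hom A B) (g : hom B C) (f' : hom A' B') (g' : hom B' C')
      (a : hom A A') (b : hom B B') (c : hom C C'),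
    is_iso a -> is_iso b -> is_iso c -> b ∘ f = f' ∘ a -> c ∘ g = g' ∘ b ->
    conflation f g -> conflation f' g';
  inflation_id : forall A : exact_cat, inflation (idm A);
  deflation_id : forall A : exact_cat, deflation (idm A);
  inflation_comp : forall (A B C : exact_cat) (f : hom A B) (g : hom B C),
    inflation f -> inflation g -> inflation (g ∘ f);
  deflation_comp : forall (A B C : exact_cat) (f : hom A B) (g : hom B C),
    deflation f -> deflation g -> deflation (g ∘ f);
  inflation_pushout : forall (A B A' : exact_cat) (f : hom A B) (a : hom A A'),
    inflation f -> exists (B' : exact_cat) (f' : hom A' B') (b : hom B B'),
      is_pushout f a f' b /\ inflation f';
  deflation_pullback : forall (B C C' : exact_cat) (g : hom B C) (c : hom C' C),
    deflation g -> exists (B' : exact_cat) (g' : hom B' C') (b : hom B' B),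
      is_pullback g c g' b /\ deflation g'
}.

Arguments conflation {e A B C} _ _.
Arguments inflation {e A B} _.
Arguments deflation {e B C} _.

Section Exact.
Variable E : exactCategory.
Implicit Types (A B C K M : E) (S T X : set E) (n i : nat).

(* [exseq C n M] is the type of exact sequences
     0 -> M -> B_1 -> ... -> B_n -> C -> 0
   with n >= 1 middle terms, spliced from n conflations; the objects K through
   which the inner differentials factor are part of the data. The type is empty
   for n = 0. *)
Inductive exseq C : nat -> E -> Type :=
| Short M B (f : hom M B) (g : hom B C) of conflation f g : exseq C 1 M
| Splice n M B K (f : hom M B) (g : hom B K) of conflation f g
    & exseq C n K : exseq C n.+1 M.

Fixpoint middle_terms_in X C n M (s : exseq C n M) : Prop :=
  match s with
  | @Short _ _ B _ _ _ => X B
  | @Splice _ _ _ B _ _ _ _ s' => X B /\ middle_terms_in X s'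
  end.

(* Morphisms of exact sequences which are [a] on the left end and the identity
   on the right end C. The components on the intermediate objects K are uniquely
   determined by those on the middle terms. *)
Inductive exseq_mor C : forall n M M',
    hom M M' -> exseq C n M -> exseq C n M' -> Prop :=
| ShortMor M B (f : hom M B) (g : hom B C) (fg : conflation f g)
    M' B' (f' : hom M' B') (g' : hom B' C) (fg' : conflation f' g')
    (a : hom M M') (b : hom B B') of
    b ∘ f = f' ∘ a & g = g' ∘ b :
    exseq_mor a (Short fg) (Short fg')
| SpliceMor n M B K (f : hom M B) (g : hom B K) (fg : conflation f g)
    (s : exseq C n K)
    M' B' K' (f' : hom M' B') (g' : hom B' K') (fg' : conflation f' g')
    (s' : exseq C n K')
    (a : hom M M') (b : hom B B') (c : hom K K') of
    b ∘ f = f' ∘ a & c ∘ g = g' ∘ b & exseq_mor c s s' :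
    exseq_mor a (Splice fg s) (Splice fg' s').

Definition yoneda_equiv C n M : relation (exseq C n M) :=
  clos_refl_sym_trans _ (exseq_mor (idm M)).

(* The underlying set of the Yoneda group Ext^i(C, M), for i >= 1. *)
Definition Ext i C M : set (set (exseq C i M)) :=
  range (fun s => [set t | yoneda_equiv s t]).
Arguments Ext : clear implicits.

(* A group is zero exactly when its underlying set is a singleton, so the Baer
   sum is not needed to express vanishing. *)
Definition Ext_vanishes i C M : Prop := exists z, Ext i C M = [set z].

Definition perp S : set E :=
  [set M | forall i C, (1 <= i)%N -> S C -> Ext_vanishes i C M].

(* 0 -> M -> X_0 -> ... -> X_n -> 0 is an exact sequence with n + 1 middle terms
   and zero right end. *)
Definition Cores n X : set E :=
  [set M | exists Z (s : exseq Z n.+1 M),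
     is_zero_object Z /\ middle_terms_in X s].

Definition Cores_all X : set E := \bigcup_n Cores n X.

Definition subcategory S : Prop :=
  [/\ forall Z : E, is_zero_object Z -> S Z,
      forall A B D : E, S A -> S B -> is_direct_sum A B D -> S D
    & forall A B : E, isomorphic A B -> S A -> S B].

Definition extension_closed X : Prop :=
  forall A B C (f : hom A B) (g : hom B C),
    conflation f g -> X A -> X C -> X B.

Definition inflation_closed X : Prop :=
  forall A B C (f : hom A B) (g : hom B C),
    conflation f g -> X A -> X B -> X C.

Definition coresolving X : Prop :=
  [/\ extension_closed X, inflation_closed X
    & forall M, exists2 B, X B & exists f : hom M B, inflation f].

Definition finitely_coresolving X : Prop :=
  coresolving X /\ Cores_all X = setT.

(* The conflations of the fully exact subcategory X. *)
Definition conflation_in X A B C (f : hom A B) (g : hom B C) : Prop :=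
  [/\ X A, X B, X C & conflation f g].

Definition Proj X : set E :=
  [set P | X P /\
     forall A B C (f : hom A B) (g : hom B C), conflation_in X f g ->
       forall h : hom P C, exists k : hom P B, g ∘ k = h].

Definition enough_projectives X : Prop :=
  forall M, X M -> exists K P (f : hom K P) (g : hom P M),
    Proj X P /\ conflation_in X f g.

Definition tilting T : Prop :=
  [/\ subcategory T,
      [/\ T `<=` perp T, enough_projectives (perp T) & Proj (perp T) = T]
    & finitely_coresolving (perp T)].

Definition n_tilting n T : Prop := tilting T /\ Cores n (perp T) = setT.

Definition tilting_coresolving X : Prop :=
  [/\ subcategory X, finitely_coresolving X, enough_projectives X
    & X = perp (Proj X)].

End Exact.

Arguments Ext {E} i C M.

Definition mutually_inverse_bijections (aT rT : Type) (A : set aT) (B : set rT)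
    (f : aT -> rT) (g : rT -> aT) : Prop :=
  [/\ set_bij A B f, set_bij B A g, {in A, cancel f g} & {in B, cancel g f}].

(* Main.v *)
(* Both assignments are well defined, and mutually inverse, almost directly from
   the definitions: for T tilting, P(T^perp) = T gives
   T^perp = P(T^perp)^perp, and for X as in (2), X = P(X)^perp turns the
   conditions on X into those on P(X)^perp. What remains is that T^perp and P(X)
   are subcategories. For P(X) this is a lifting argument; for T^perp it holds
   since any coresolving class contains the zero objects (as cokernels of
   identities) and is closed under isomorphisms and direct sums (as extensions by
   a zero object, and as split extensions). *)
From mathcomp Require Import all_boot.
From mathcomp Require Import ssralg.
From mathcomp Require Import classical_sets.
Require Import Defs.

Set Implicit Arguments.
Unset Strict Implicit.
Unset Printing Implicit Defensive.

Import GRing.Theory.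

Local Open Scope classical_set_scope.
Local Open Scope ring_scope.
Local Open Scope cat_scope.

Section Preadditive.
Variable C : preadditiveCategory.
Implicit Types A B D S Z : C.

Lemma comp0m A B D (f : hom A B) : (0 : hom B D) ∘ f = 0.
Proof. by apply: (addrI (0 ∘ f)); rewrite -compDl !addr0. Qed.

Lemma compm0 A B D (g : hom B D) : g ∘ (0 : hom A B) = 0.
Proof. by apply: (addrI (g ∘ 0)); rewrite -compDr !addr0. Qed.

Lemma is_iso_idm A : is_iso (idm A).
Proof. by exists (idm A); rewrite !comp1m. Qed.

Lemma zero_object_iso Z Z' : is_zero_object Z -> is_zero_object Z' ->
  is_iso (0 : hom Z Z').
Proof.
move=> [_ Z0] [_ Z'0]; exists 0; rewrite !comp0m.
by rewrite (Z0 _ (idm Z)) (Z'0 _ (idm Z')).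
Qed.

Lemma idm0_zero_object Z : idm Z = 0 -> is_zero_object Z.
Proof.
move=> Z0; split=> A f; first by rewrite -[f]comp1m Z0 comp0m.
by rewrite -[f]compm1 Z0 compm0.
Qed.

Lemma kernel_mono A B D (f : hom A B) (g : hom B D) : is_kernel f g ->
  forall Y (h k : hom Y A), f ∘ h = f ∘ k -> h = k.
Proof.
move=> [gf0 ker_f] Y h k fhk.
have [|l [_ l_uniq]] := ker_f Y (f ∘ h); first by rewrite compA gf0 comp0m.
by rewrite -(l_uniq h) // -(l_uniq k).
Qed.

Lemma cokernel_epi A B D (f : hom A B) (g : hom B D) : is_cokernel f g ->
  forall Y (h k : hom D Y), h ∘ g = k ∘ g -> h = k.
Proof.
move=> [gf0 coker_g] Y h k hkg.
have [|l [_ l_uniq]] := coker_g Y (h ∘ g); first by rewrite -compA gf0 compm0.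
by rewrite -(l_uniq h) // -(l_uniq k).
Qed.

End Preadditive.

Section Exact.
Variable E : exactCategory.
Implicit Types (A B S Z : E) (T X : set E).

(** A cokernel [g] of [idm A] equals [g ∘ idm A = 0] and is epi, so its target is a zero object;
    this one can be exchanged for [Z] along an isomorphism. *)
Lemma conflation_id_zero A Z : is_zero_object Z ->
  conflation (idm A) (0 : hom A Z).
Proof.
move=> Z0; have [D [g cg]] := inflation_id A.
have g0 : g = 0 by have [<- _] := conflation_cokernel cg; rewrite compm1.
have D0 : is_zero_object D.
  apply: idm0_zero_object; apply: (cokernel_epi (conflation_cokernel cg)).
  by rewrite comp1m comp0m.
apply: (conflation_iso (is_iso_idm A) (is_iso_idm A) (zero_object_iso D0 Z0) _ _ cg).
  by [].
by rewrite !comp0m.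
Qed.

Lemma conflation_iso_zero A B Z (f : hom A B) : is_iso f -> is_zero_object Z ->
  conflation f (0 : hom B Z).
Proof.
move=> f_iso Z0.
apply: (conflation_iso (is_iso_idm A) f_iso (is_iso_idm Z) _ _
  (conflation_id_zero A Z0)) => //.
by rewrite comp0m compm0.
Qed.

(** Dually, the kernel of [idm A] is both zero and mono, so its source is a zero object. *)
Lemma inflation_from_zero A : exists Z (f : hom Z A),
  is_zero_object Z /\ inflation f.
Proof.
have [Z [f cf]] := deflation_id A.
have f0 : f = 0 by have [<- _] := conflation_kernel cf; rewrite comp1m.
exists Z, f; split; last by exists A, (idm A).
apply: idm0_zero_object; apply: (kernel_mono (conflation_kernel cf)).
by rewrite f0 !comp0m.
Qed.

(* A direct sum of A and B is a pushout of 0 -> B along 0 -> A, so the inflation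
   0 -> B is carried to the inclusion of A. *)
Lemma conflation_biproduct A B S (iA : hom A S) (iB : hom B S)
    (pA : hom S A) (pB : hom S B) :
  is_biproduct iA iB pA pB -> conflation iA pB.
Proof.
move=> [pAiA pBiB pAiB pBiA iSp].
have [Z [f [Z0 f_infl]]] := inflation_from_zero B.
have [P [jA [jB [[_ P_univ] [D [g cg]]]]]] := inflation_pushout (0 : hom Z A) f_infl.
have zeroZ Y (u v : hom Z Y) : u = v by rewrite (Z0.2 _ u) (Z0.2 _ v).
have [w [[wB wA] _]] := P_univ S iB iA (zeroZ _ _ _).
(* The inverse of the comparison map [w] from the pushout [P] to [S]. *)
pose v := jA ∘ pA + jB ∘ pB.
have vw : v ∘ w = idm P.
  (* Both [v ∘ w] and [idm P] solve the pushout problem posed by [jB] and [jA]. *)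
  have [x [_ x_uniq]] := P_univ P jB jA (zeroZ _ _ _).
  rewrite -(x_uniq (idm P)); last by rewrite !comp1m.
  symmetry; apply: x_uniq; rewrite -!compA wB wA /v !compDl -!compA.
  by rewrite pAiA pAiB pBiA pBiB !compm0 !compm1 addr0 add0r.
have wv : w ∘ v = idm S by rewrite /v compDr !compA wA wB.
have [gjA coker_g] := conflation_cokernel cg.
have [|c [cgE _]] := coker_g B (pB ∘ w); first by rewrite -compA wA.
(* Since [D] is the cokernel of [jA], it is a copy of [B]; then [w] and [c] carry the conflation
   [jA], [g] to [iA], [pB]. *)
have c_iso : is_iso c.
  exists (g ∘ jB); split; last by rewrite compA cgE -compA wB.
  apply: (cokernel_epi (conflation_cokernel cg)).
  rewrite comp1m -compA cgE -[RHS]compm1 -vw /v compDl compDr.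
  by rewrite !compA gjA !comp0m add0r.
have w_iso : is_iso w by exists v.
by apply: (conflation_iso (is_iso_idm A) w_iso c_iso _ cgE cg); rewrite compm1.
Qed.

Lemma coresolving_subcategory X : coresolving X -> subcategory X.
Proof.
move=> [X_ext X_infl X_enough].
have X0 Z : is_zero_object Z -> X Z.
  (* Embedding [Z] supplies some object [B] of [X]; [Z] is then a cokernel of [idm B]. *)
  move=> Z0; have [B XB _] := X_enough Z.
  exact: (X_infl _ _ _ _ _ (conflation_id_zero B Z0) XB XB).
split=> [//|A B S XA XB [iA [iB [pA [pB AB]]]] | A B [f f_iso] XA].
  exact: (X_ext _ _ _ _ _ (conflation_biproduct AB) XA XB).
have [Z Z0] := zero_exists E.
exact: (X_ext _ _ _ _ _ (conflation_iso_zero f_iso Z0) XA (X0 _ Z0)).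
Qed.

Lemma Proj_subcategory X : subcategory X -> subcategory (Proj X).
Proof.
move=> [X0 XD Xiso]; split=> [Z Z0 | A B S [XA PA] [XB PB] AB | A B AB [XA PA]].
- split=> [|A B D f g _ h]; first exact: X0.
  by exists 0; rewrite compm0 (Z0.2 _ h).
- split=> [|A' B' D' f g fg h]; first exact: (XD _ _ _ XA XB AB).
  have [iA [iB [pA [pB [_ _ _ _ iSp]]]]] := AB.
  have [k gk] := PA _ _ _ _ _ fg (h ∘ iA).
  have [l gl] := PB _ _ _ _ _ fg (h ∘ iB).
  (* The lifts of the restrictions of [h] to the two summands are glued along [iSp]. *)
  exists (k ∘ pA + l ∘ pB).
  by rewrite compDr !compA gk gl -!compA -compDr iSp compm1.
- split=> [|A' B' D' f g fg h]; first exact: (Xiso _ _ AB XA).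
  have [a [b [_ ab]]] := AB.
  have [k gk] := PA _ _ _ _ _ fg (h ∘ a).
  by exists (k ∘ b); rewrite compA gk -compA ab compm1.
Qed.

Lemma tilting_coresolving_perp T : tilting T -> tilting_coresolving (perp T).
Proof.
move=> [_ [_ enoughP ProjT] [cores fin]].
split=> //; last by rewrite ProjT.
exact: coresolving_subcategory.
Qed.

Lemma tilting_Proj X : tilting_coresolving X -> tilting (Proj X).
Proof.
(* Once [perp (Proj X)] is replaced by [X], the inclusion in (T1) reads [Proj X] inside [X]. *)
move=> [subX corX enoughP XE]; split; rewrite -?XE //.
  exact: Proj_subcategory.
by split=> // A [].
Qed.

End Exact.

(** Each inverse law gives injectivity of one map and surjectivity of the other. *)
Lemma mutually_inverse_bijectionsP (aT rT : Type) (A : set aT) (B : set rT)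
    (f : aT -> rT) (g : rT -> aT) :
  (forall x, A x -> B (f x)) -> (forall y, B y -> A (g y)) ->
  (forall x, A x -> g (f x) = x) -> (forall y, B y -> f (g y) = y) ->
  mutually_inverse_bijections A B f g.
Proof.
move=> fAB gBA fK gK; split.
- split=> [x Ax | x y /set_mem Ax /set_mem Ay fxy | y By].
  + exact: fAB.
  + by rewrite -(fK x) // -(fK y) // fxy.
  + by exists (g y); [exact: gBA | exact: gK].
- split=> [y By | x y /set_mem Bx /set_mem By gxy | x Ax].
  + exact: gBA.
  + by rewrite -(gK x) // -(gK y) // gxy.
  + by exists (f x); [exact: fAB | exact: fK].
- by move=> x /set_mem /fK.
- by move=> y /set_mem /gK.
Qed.

Theorem theorem4p10 (E : exactCategory) (hE : idempotent_complete E) :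
  mutually_inverse_bijections
    [set T : set E | tilting T]
    [set X : set E | tilting_coresolving X]
    (@perp E) (@Proj E)
  /\ forall n : nat,
     mutually_inverse_bijections
       [set T : set E | n_tilting n T]
       [set X : set E | tilting_coresolving X /\ Cores n X = setT]
       (@perp E) (@Proj E).
Proof.
have perpK (T : set E) : tilting T -> Proj (perp T) = T by case=> _ [].
have ProjK (X : set E) : tilting_coresolving X -> perp (Proj X) = X by case.
split=> [|n]; apply: mutually_inverse_bijectionsP => //=.
- exact: tilting_coresolving_perp.
- exact: tilting_Proj.
- by move=> T [/tilting_coresolving_perp].
(* [ProjK] turns the condition on [Cores n (perp (Proj X))] into the one on [Cores n X]. *)
- by move=> X [tX XE]; split; [exact: tilting_Proj | rewrite ProjK].
- by move=> T [/perpK].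
- by move=> X [/ProjK].
Qed.
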